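(* Let $i:U\to\mathbb{H}^{n+1}$ be a smooth immersion of an open set $U\subset\mathbb{R}^n$ with unit normal field $N$, and let $i_t(x)=\psi^t(i(x),N_{i(x)})$ define the parallel hypersurfaces. The first and second fundamental forms satisfy the following equations under the parallel flow: (a) $\dfrac{dg_{ij}}{dt}=-2\Pi_{ij}$; (b) $\dfrac{d\Pi^i_j}{dt}=\Pi^i_l\Pi^l_j-\delta^i_j$ (summation over $l$; for $(t,x)$ at which $g_{ij}(t,x)$ is invertible); (c) $\dfrac{d^2\Pi_{ij}}{dt^2}=4\Pi_{ij}$.
   Context: $\mathbb{H}^{n+1}$ is hyperbolic space of constant curvature $-1$, with metric $\langle\cdot,\cdot\rangle$ and Levi-Civita connection $\nabla$; $\psi^t(p,X)=\exp_p(tX)$. For coordinates $(x_1,\dots,x_n)$ on $U$, $X_j=(i_t)_*\partial_{x_j}$ are the coordinate vector fields along the parallel hypersurface at time $t$, and $N=\frac{d}{dt}\psi^t(i(x),N_{i(x)})$ is the unit normal field extended along the normal geodesics. The quantities at time $t$ are $g_{ij}=\langle X_i,X_j\rangle$, $\Pi_{ij}=\langle\nabla_{X_j}X_i,N\rangle$, and $\Pi^i_j=g^{ik}\Pi_{kj}$, where $g^{ij}$ is the inverse of $g_{ij}$. $\frac{d}{dt}$ is differentiation in $t$ for fixed $x\in U$. *)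

(* Defs.v *)
From mathcomp Require Export all_boot all_order all_algebra.
From mathcomp Require Export all_classical all_reals all_analysis.

Set Implicit Arguments.
Unset Strict Implicit.
Unset Printing Implicit Defensive.

Export Order.TTheory GRing.Theory Num.Theory numFieldNormedType.Exports.

Local Open Scope classical_set_scope.
Local Open Scope ring_scope.

(* Hyperbolic space H^m is the hyperboloid model: the upper sheet of            *)
(* <p, p> = -1 in Minkowski space R^{1,m} = 'rV[R]_m.+1, coordinate 0 being     *)
(* the timelike one, with the Riemannian metric induced by < , >.              *)

Section Hyperbolic.
Context {R : realType} {m : nat}.
Implicit Types (p u v w : 'rV[R]_m.+1).

Definition mink u v : R :=
  - (u 0 0 * v 0 0) + \sum_(k < m) u 0 (lift ord0 k) * v 0 (lift ord0 k).

Definition hyperboloid : set 'rV[R]_m.+1 :=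
  [set p | mink p p = -1 /\ 0 < p 0 0].

Definition tangent p : set 'rV[R]_m.+1 := [set v | mink p v = 0].

(* The <,>-orthogonal projection onto [tangent p]; the sign is + because the    *)
(* normal direction p satisfies <p, p> = -1.                                   *)
Definition tproj p v : 'rV[R]_m.+1 := v + mink p v *: p.

(* Levi-Civita covariant derivative, in the direction v, of a field V of        *)
(* tangent vectors along a map f into the hyperboloid (the pull-back            *)
(* connection): the tangential part of the flat derivative. For f a curve and   *)
(* v = 1 it is the covariant derivative along the curve. Lemmas [hcov_tangent], *)
(* [hcov_metric] and [hcov_symmetric] below are its characteristic properties. *)
Definition hcov {E : normedModType R} (f V : E -> 'rV[R]_m.+1) (v x : E) :
  'rV[R]_m.+1 := tproj (f x) ('D_v V x).

Definition is_geodesic (gam : R -> 'rV[R]_m.+1) : Prop :=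
  [/\ forall t, hyperboloid (gam t),
      forall t, derivable gam t 1,
      forall t, derivable (derive1 gam) t 1 &
      forall t, hcov gam (derive1 gam) 1 t = 0].

(* The value p is a dummy, returned only if there is no such geodesic. *)
Definition hexp p v : 'rV[R]_m.+1 :=
  xget p [set q | exists gam, [/\ is_geodesic gam, gam 0 = p,
                                  derive1 gam 0 = v & gam 1 = q]].

Definition psi (t : R) p v : 'rV[R]_m.+1 := hexp p (t *: v).

Lemma minkC u v : mink u v = mink v u.
Proof.
by rewrite /mink mulrC; congr (_ + _); apply: eq_bigr => k _; rewrite mulrC.
Qed.

Lemma minkDr u v w : mink u (v + w) = mink u v + mink u w.
Proof.
rewrite /mink !mxE mulrDr opprD addrACA -big_split/=; congr (_ + _).
by apply: eq_bigr => k _; rewrite !mxE mulrDr.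
Qed.

Lemma minkZr a u v : mink u (a *: v) = a * mink u v.
Proof.
rewrite /mink !mxE mulrDr mulrN mulrCA mulr_sumr; congr (_ + _).
by apply: eq_bigr => k _; rewrite !mxE mulrCA.
Qed.

Lemma mink_tproj p u v : tangent p u -> mink u (tproj p v) = mink u v.
Proof. by move=> /= pu; rewrite minkDr minkZr [mink u p]minkC pu mulr0 addr0. Qed.

Lemma hcov_tangent (E : normedModType R) (f V : E -> 'rV[R]_m.+1) (v x : E) :
  hyperboloid (f x) -> tangent (f x) (hcov f V v x).
Proof. by move=> [ff _]; rewrite /tangent/= minkDr minkZr ff mulrN1 subrr. Qed.

Lemma is_derive_mink (E : normedModType R) (V W : E -> 'rV[R]_m.+1) (v x : E) :
  derivable V x v -> derivable W x v ->
  is_derive x v (fun y => mink (V y) (W y))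
    (mink ('D_v V x) (W x) + mink (V x) ('D_v W x)).
Proof.
move=> dV dW.
have dC (F : E -> 'rV[R]_m.+1) k : derivable F x v ->
    is_derive x v (fun y => F y 0 k) ('D_v F x 0 k).
  move=> dF; rewrite derive_mx// mxE; apply: derivableP.
  by move/derivable_mxP : dF; apply.
have dM k : is_derive x v (fun y => V y 0 k * W y 0 k)
    ('D_v V x 0 k * W x 0 k + V x 0 k * 'D_v W x 0 k).
  apply: is_derive_eq; first exact: is_deriveM (dC _ k dV) (dC _ k dW).
  by rewrite addrC; congr (_ + _); exact: mulrC.
apply: is_derive_eq.
  apply: is_deriveD (is_deriveN (dM 0)) _.
  have := is_derive_sum (fun k => dM (lift ord0 k)).
  by rewrite fct_sumE; apply.
by rewrite /mink big_split/= opprD addrACA.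
Qed.

Lemma hcov_metric (E : normedModType R) (f V W : E -> 'rV[R]_m.+1) (v x : E) :
  tangent (f x) (V x) -> tangent (f x) (W x) ->
  derivable V x v -> derivable W x v ->
  'D_v (fun y => mink (V y) (W y)) x =
    mink (hcov f V v x) (W x) + mink (V x) (hcov f W v x).
Proof.
move=> tV tW dV dW; have [_ ->] := is_derive_mink dV dW.
by rewrite [mink (hcov _ _ _ _) _]minkC !mink_tproj// [mink (W x) _]minkC.
Qed.

Lemma hcov_symmetric (E : normedModType R) (f : E -> 'rV[R]_m.+1) (u v x : E) :
  'D_u ('D_v f) x = 'D_v ('D_u f) x ->
  hcov f ('D_v f) u x = hcov f ('D_u f) v x.
Proof. by rewrite /hcov => ->. Qed.

End Hyperbolic.

Section Smooth.
Context {R : realType} {n : nat} {W : normedModType R}.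

Definition basis_vec (j : 'I_n) : 'rV[R]_n := delta_mx 0 j.

Definition iter_partial (s : seq 'I_n) (f : 'rV[R]_n -> W) : 'rV[R]_n -> W :=
  foldr (fun j h => 'D_(basis_vec j) h) f s.

(* C^infty on U: partial derivatives of all orders exist and are continuous.   *)
(* Used for open U only. A map into the hyperboloid, a properly embedded        *)
(* submanifold, is smooth iff it is smooth as a map into the ambient space.    *)
Definition smooth_on (U : set 'rV[R]_n) (f : 'rV[R]_n -> W) : Prop :=
  forall (s : seq 'I_n) (x : 'rV[R]_n), U x ->
    {for x, continuous (iter_partial s f)} /\
    forall j, derivable (iter_partial s f) x (basis_vec j).

End Smooth.

Section ParallelHypersurfaces.
Context {R : realType} {n : nat}.
Implicit Types (U : set 'rV[R]_n) (i N : 'rV[R]_n -> 'rV[R]_n.+2).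

Definition smooth_immersion U i : Prop :=
  [/\ smooth_on U i,
      forall x, U x -> hyperboloid (i x) &
      forall x, U x -> injective ('d i x)].

Definition unit_normal_field U i N : Prop :=
  smooth_on U N /\
  forall x, U x ->
    [/\ tangent (i x) (N x),
        forall v, mink ('d i x v) (N x) = 0 &
        mink (N x) (N x) = 1].

Variables i N : 'rV[R]_n -> 'rV[R]_n.+2.

Definition parallel (t : R) (x : 'rV[R]_n) : 'rV[R]_n.+2 := psi t (i x) (N x).

Definition coord_field (t : R) (j : 'I_n) (x : 'rV[R]_n) : 'rV[R]_n.+2 :=
  'D_(basis_vec j) (parallel t) x.

Definition normal_field (t : R) (x : 'rV[R]_n) : 'rV[R]_n.+2 :=
  derive1 (fun s => psi s (i x) (N x)) t.

Definition first_form (t : R) (x : 'rV[R]_n) : 'M[R]_n :=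
  \matrix_(j, k) mink (coord_field t j x) (coord_field t k x).

Definition second_form (t : R) (x : 'rV[R]_n) : 'M[R]_n :=
  \matrix_(j, k)
    mink (hcov (parallel t) (coord_field t j) (basis_vec k) x)
         (normal_field t x).

Definition mixed_form (t : R) (x : 'rV[R]_n) : 'M[R]_n :=
  invmx (first_form t x) *m second_form t x.

End ParallelHypersurfaces.

(* Main.v *)
Require Import Defs.
From mathcomp Require Import perm ring lra.

Local Open Scope classical_set_scope.
Local Open Scope ring_scope.

(** In the hyperboloid model the geodesic issued from p with unit velocity v
    is [cosh t *: p + sinh t *: v], because a geodesic gam satisfies the
    linear equation gam'' = <gam', gam'> gam, whose coefficient is constant
    ([geodesic_acceleration], [geodesic_unique], [psiE]). So the parallel
    hypersurfaces and their normals are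
      i_t = cosh t i + sinh t N   and   N_t = sinh t i + cosh t N,
    and, with X the n x (n+2) matrix of coordinate fields D_j i_t and Y that
    of the D_j N_t, one has X' = Y and Y' = X.

    Write (A, B) for the matrix of Minkowski products of the rows of A and B.
    Then g = (X, X), and differentiating the relations <D_j i_t, N_t> = 0 gives
    Pi = - (X, Y). The matrix (X, Y) is symmetric: up to sign its entries at
    time 0 are <D_k D_j i, N>, and second derivatives commute ([schwarz]).
    Hence g' = (Y, X) + (X, Y) = - 2 Pi, which is (a); next
    Pi' = - (Y, Y) - (X, X), and Pi'' = - 2 (X, Y) - 2 (Y, X) = 4 Pi, which is
    (c).

    For (b), when g is invertible the rows of X together with i and N form a
    basis of Minkowski space, and the rows of Y are orthogonal to i and N.
    So Y is a combination of the rows of X, whence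
    (Y, Y) = (Y, X) g^-1 (X, Y) = Pi g^-1 Pi ([gram_span]), that is
    Pi' = - Pi g^-1 Pi - g. Together with g' = - 2 Pi this is exactly what the
    product rule needs to give S' = S S - 1 for S = g^-1 Pi ([riccati]).

    Smoothness is given through iterated partial derivatives, whereas
    normality of N is given through the differential of i: the bridge is that
    continuous partial derivatives imply differentiability
    ([differentiable_C1]). *)

(** * Functions with continuous partial derivatives *)

(** This brings directional derivatives within reach of the mean value theorem
    for functions of a real variable. *)
Lemma is_derive_line (R : numFieldType) (E W : normedModType R) (f : E -> W)
    (x v : E) (s : R) :
  derivable f (s *: v + x) v ->
  is_derive s 1 (fun c : R => f (c *: v + x)) ('D_v f (s *: v + x)).
Proof.
have quotE : (fun h : R => h^-1 *: (((fun c => f (c *: v + x)) \o shift s) (h *: 1)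
      - f (s *: v + x))) =
    (fun h => h^-1 *: ((f \o shift (s *: v + x)) (h *: v) - f (s *: v + x))).
  by apply/funext => h /=; rewrite [h%:A]mulr1 scalerDl addrA.
by move=> df; split; rewrite /derivable /derive quotE.
Qed.

(** The mean value theorem between 0 and a point of either sign, so that an
    increment along a coordinate needs no case analysis. *)
Lemma mean_value (R : realType) (f df : R -> R) (a : R) :
  (forall s : R, `|s| <= `|a| -> is_derive s 1 f (df s)) ->
  exists2 c, `|c| <= `|a| & f a - f 0 = df c * a.
Proof.
move=> fd.
have fc (u w : R) : - `|a| <= u -> w <= `|a| -> {within `[u, w], continuous f}.
  move=> au wa; apply: derivable_within_continuous => s.
  rewrite in_itv/= => /andP[us sw].
  have [] // := fd s; rewrite ler_norml (le_trans au us)//= (le_trans sw)//.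
have [a0|a0] := leP 0 a.
  have [||c ca] := @MVT_segment R f df 0 a a0.
  - move=> s; rewrite in_itv/= => /andP[s0 sa]; apply: fd.
    by rewrite !ger0_norm// ltW.
  - by apply: fc; rewrite ger0_norm// oppr_le0.
  - move: ca; rewrite in_itv/= subr0 => /andP[c0 ca] ->.
    by exists c => //; rewrite !ger0_norm.
have [||c ca] := @MVT_segment R f df a 0 (ltW a0).
- move=> s; rewrite in_itv/= => /andP[s0 sa]; apply: fd.
  by rewrite !ltr0_norm// lerN2 ltW.
- by apply: fc; rewrite ltr0_norm ?opprK// oppr_ge0 ltW.
- move: ca; rewrite in_itv/= sub0r mulrN => /andP[c0 ca] e.
  exists c; first by rewrite !ler0_norm ?lerN2// ltW.
  by rewrite -opprB e opprK.
Qed.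

Lemma mean_value_line (R : realType) (E : normedModType R) (f : E -> R)
    (x v : E) (a : R) :
  (forall s : R, `|s| <= `|a| -> derivable f (s *: v + x) v) ->
  exists2 c, `|c| <= `|a| & f (a *: v + x) - f x = 'D_v f (c *: v + x) * a.
Proof.
move=> df.
have [|c ca] := @mean_value R (fun c => f (c *: v + x)) (fun c => 'D_v f (c *: v + x)) a.
  by move=> s sa; apply: is_derive_line; exact: df.
by rewrite scale0r add0r => e; exists c.
Qed.

Lemma differentiable_approx (R : numFieldType) (E W : normedModType R)
    (f : E -> W) (L : {linear E -> W}) (x : E) :
  continuous L ->
  (forall e : R, 0 < e ->
     \forall h \near 0, `|f (h + x) - (f x + L h)| <= e * `|h|) ->
  differentiable f x.
Proof.
move=> Lc approx; have Lf : f \o shift x = cst (f x) + L +o_ 0 id.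
  by apply/eqaddoP => e e0; exact: approx.
by apply/diff_locallyP; rewrite (diff_unique Lc Lf).
Qed.

Lemma linear_form_rV (R : numFieldType) (n : nat) (d : 'I_n -> R) :
  exists L : {linear 'rV[R]_n -> R},
    continuous L /\ forall h, L h = \sum_j h 0 j * d j.
Proof.
have @L : {linear 'rV[R]_n -> R}.
  exists (fun h : 'rV[R]_n => \sum_j h 0 j * d j); do 2![eexists]; do ?[constructor].
  - by rewrite big1// => j _; rewrite mxE mul0r.
  - by move=> u w; rewrite -big_split; apply: eq_bigr => j _; rewrite mxE mulrDl.
  - move=> a u; rewrite /GRing.scale/= mulr_sumr.
    by apply: eq_bigr => j _; rewrite mxE mulrA.
exists L; split=> // h.
apply: (@cvg_big R^o _ +%R 0 _ (@add_continuous R^o) _ (nbhs h)) => j _.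
have hj : (y : 'rV[R]_n) 0 j @[y --> h] --> h 0 j := @coord_continuous _ _ _ _ _ h.
exact: cvgMr_tmp hj.
Qed.

(** The increment f (x + h) - f x is telescoped along the path which changes
    one coordinate at a time; each step is, by the mean value theorem, a
    partial derivative at a point close to x times a coordinate of h. *)
Lemma differentiable_C1 (R : realType) (n : nat) (f : 'rV[R]_n -> R)
    (x : 'rV[R]_n) :
  (forall j, \forall y \near x, derivable f y (basis_vec j)) ->
  (forall j, {for x, continuous ('D_(basis_vec j) f)}) ->
  differentiable f x.
Proof.
move=> fd fc; set d := fun j => 'D_(basis_vec j) f x.
have [L [Lc LE]] := @linear_form_rV R n d.
apply: (@differentiable_approx R _ _ f L x Lc) => e e0.
(* Each of the n steps may cost e' |h|; n.+1 avoids a division by zero. *)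
pose e' := e / n.+1%:R.
have e'0 : 0 < e' by rewrite divr_gt0.
have : \forall y \near x, forall j : 'I_n,
    derivable f y (basis_vec j) /\ `|d j - 'D_(basis_vec j) f y| < e'.
  apply: (@filter_forall _ _ _ (nbhs x) _ _) => j; apply: filterI; first exact: fd.
  exact: (cvgr_dist_lt _ _ (fc j) _ e'0).
case/nbhs_ballP => r /= r0 near_x.
apply/nbhs_ballP; exists r => //= h; rewrite -ball_normE/= sub0r normrN => hr.
rewrite /=.
(* The m-th vertex of the path: only the first m coordinates of h are on. *)
pose H m : 'rV[R]_n := \row_j (if (j < m)%N then h 0 j else 0).
have coord_le j : `|h 0 j| <= `|h|.
  by rewrite [leRHS]/Num.Def.normr/= mx_normrE (le_bigmax _ _ (0, j)).
suff partial m : (m <= n)%N ->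
    `|f (H m + x) - (f x + \sum_(j < n | (j < m)%N) h 0 j * d j)| <= m%:R * (e' * `|h|).
  have := partial n (leqnn n).
  rewrite (_ : H n = h); last by apply/rowP => j; rewrite mxE ltn_ord.
  rewrite LE (eq_bigl _ _ (@ltn_ord n)) => /le_trans; apply.
  rewrite mulrA ler_wpM2r// /e' mulrCA ler_piMr ?(ltW e0)//.
  by rewrite ler_pdivrMr// mul1r ler_nat.
elim: m => [_|m IH mn].
  rewrite (_ : H 0 = 0); last by apply/rowP => j; rewrite !mxE.
  by rewrite add0r big_pred0_eq addr0 subrr normr0 mul0r.
pose k := Ordinal mn.
have HS : H m.+1 = h 0 k *: basis_vec k + H m.
  apply/rowP => j; rewrite !mxE eqxx /= ltnS leq_eqVlt -(inj_eq val_inj)/=.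
  have [jm|jm] := eqVneq (j : nat) m; last by rewrite mulr0 add0r.
  rewrite jm ltnn mulr1 addr0; congr (h 0 _); exact: val_inj.
rewrite HS -addrA.
have inball s : `|s| <= `|h 0 k| -> ball x r (s *: basis_vec k + (H m + x)).
  move=> sh; rewrite -ball_normE /= addrA opprD addrCA subrr addr0 normrN.
  apply: le_lt_trans hr.
  rewrite [leLHS]/Num.Def.normr/= mx_normrE bigmax_le//= => -[i j] _ /=.
  rewrite !mxE (ord1 i) eqxx /=.
  have [->|jk] := eqVneq j k; first by rewrite mulr1 ltnn addr0 (le_trans sh).
  by rewrite mulr0 add0r; case: ifP => // _; rewrite normr0.
have [|c ck fE] := @mean_value_line R _ f (H m + x) (basis_vec k) (h 0 k).
  by move=> s /inball /near_x /(_ k)[].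
rewrite (bigD1 k) /= ?ltnS//.
rewrite (eq_bigl (fun j : 'I_n => (j < m)%N)); last first.
  by move=> j; rewrite ltnS leq_eqVlt -(inj_eq val_inj)/=; case: ltngtP.
set S := \sum_(j < n | _) _.
set D := 'D_(basis_vec k) f (c *: basis_vec k + (H m + x)).
rewrite (_ : _ - _ = (f (H m + x) - (f x + S)) + (D - d k) * h 0 k); last first.
  by rewrite -(subrK (f (H m + x)) (f _)) fE -/D; ring.
rewrite -natr1 [leRHS]mulrDl mul1r (le_trans (ler_normD _ _))// lerD//.
  by apply: IH; exact: ltnW.
rewrite normrM ler_pM// distrC ltW//.
by have [] := near_x _ (inball c ck) k.
Qed.

(** * Symmetry of second derivatives *)

(** Two applications of the mean value theorem, first in the direction u to
    y |-> f (y + s v) - f y and then in the direction v to D_u f. The second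
    difference itself is symmetric in u and v. *)
Lemma second_difference {R : realType} {E : normedModType R} (f : E -> R)
    {x u v : E} {r s : R} :
  0 <= s -> s * (`|u| + `|v|) < r ->
  (forall y, ball x r y -> derivable f y u) ->
  (forall y, ball x r y -> derivable ('D_u f) y v) ->
  exists2 z, ball x r z &
    f (s *: u + (s *: v + x)) - f (s *: v + x) - (f (s *: u + x) - f x) =
    'D_v ('D_u f) z * s * s.
Proof.
move=> s0 sr df ddf.
have inball (c c' : R) : `|c| <= s -> `|c'| <= s ->
    ball x r (c *: u + (c' *: v + x)).
  move=> cs c's; rewrite -ball_normE /= addrA opprD addrCA subrr addr0 normrN.
  apply: le_lt_trans sr; rewrite mulrDr (le_trans (ler_normD _ _))//.
  by rewrite !normrZ lerD// ler_wpM2r.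
have inball0 (c : R) : `|c| <= s -> ball x r (c *: u + x).
  by move=> cs; have := inball c 0 cs; rewrite scale0r add0r normr0; apply.
have [|c cs] := @mean_value R
    (fun c => f (c *: u + (s *: v + x)) - f (c *: u + x))
    (fun c => 'D_u f (c *: u + (s *: v + x)) - 'D_u f (c *: u + x)) s.
  move=> c; rewrite (ger0_norm s0) => cs.
  apply: is_deriveB; apply: is_derive_line; apply: df; last exact: inball0.
  by apply: inball => //; rewrite ger0_norm.
rewrite !scale0r !add0r => fE.
rewrite (ger0_norm s0) in cs.
have [|c' c's fE'] := @mean_value_line R E ('D_u f) (c *: u + x) v s.
  move=> c'; rewrite (ger0_norm s0) => c's.
  by apply: ddf; rewrite addrCA; exact: inball.
rewrite (ger0_norm s0) in c's.
exists (c' *: v + (c *: u + x)); first by rewrite addrCA; exact: inball.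
by rewrite -fE' [s *: v + (c *: u + x)]addrCA -fE; ring.
Qed.

Lemma eq_of_second_differences {R : fieldType} {a b c d A B s : R} :
  s != 0 -> a - b - (c - d) = A * s * s -> a - c - (b - d) = B * s * s -> A = B.
Proof.
move=> s0 Ae Be; have s20 : s * s != 0 by rewrite mulf_neq0.
by apply: (mulIf s20); rewrite !mulrA -Ae -Be; ring.
Qed.

Lemma dist_le_of_half {R : realFieldType} {A B C e : R} :
  `|A - C| < e / 2 -> `|B - C| < e / 2 -> `|A - B| <= e.
Proof.
move=> AC BC; rewrite (_ : A - B = (A - C) - (B - C)); last by ring.
by rewrite (le_trans (ler_normB _ _))// [leRHS]splitr lerD// ltW.
Qed.

(** The second difference at scale s is s^2 D_v D_u f z and s^2 D_u D_v f z'
    for two points z, z' near x; hence the two mixed derivatives take a common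
    value arbitrarily near x, and continuity concludes. *)
Lemma schwarz_scalar (R : realType) (E : normedModType R) (f : E -> R)
    (x u v : E) :
  (\forall y \near x, [/\ derivable f y u, derivable f y v,
     derivable ('D_u f) y v & derivable ('D_v f) y u]) ->
  {for x, continuous ('D_v ('D_u f))} -> {for x, continuous ('D_u ('D_v f))} ->
  'D_v ('D_u f) x = 'D_u ('D_v f) x.
Proof.
move=> df cvu cuv; apply/eqP; rewrite -subr_eq0 -normr_le0.
apply/ler_addgt0Pr => e e0; rewrite add0r.
have e20 : 0 < e / 2 by rewrite divr_gt0.
have near_v := cvgr_dist_lt _ _ cvu _ e20.
have near_u := cvgr_dist_lt _ _ cuv _ e20.
have : \forall y \near x, [/\ derivable f y u, derivable f y v,
    derivable ('D_u f) y v & derivable ('D_v f) y u] /\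
    `|'D_v ('D_u f) x - 'D_v ('D_u f) y| < e / 2 /\
    `|'D_u ('D_v f) x - 'D_u ('D_v f) y| < e / 2.
  exact: filterI df (filterI (near_v _) (near_u _)).
move=> /nbhs_ballP[r /= r0 near_x].
have [s s0 sr] : exists2 s, 0 < s & s * (`|u| + `|v|) < r.
  have uv0 : 0 < `|u| + `|v| + 1 by rewrite ltr_wpDl// addr_ge0.
  exists (r / (2 * (`|u| + `|v| + 1))); first by rewrite divr_gt0// mulr_gt0.
  rewrite mulrAC ltr_pdivrMr ?mulr_gt0// ltr_pM2l//.
  by rewrite mulr_natl mulr2n ltr_wpDl// ?ltrDl// ltW.
have dfu y : ball x r y -> derivable f y u by move=> /near_x[[? _ _ _] _].
have dfv y : ball x r y -> derivable f y v by move=> /near_x[[_ ? _ _] _].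
have dfuv y : ball x r y -> derivable ('D_u f) y v.
  by move=> /near_x[[_ _ ? _] _].
have dfvu y : ball x r y -> derivable ('D_v f) y u.
  by move=> /near_x[[_ _ _ ?] _].
have [z rz fz] := second_difference f (ltW s0) sr dfu dfuv.
rewrite addrC in sr.
have [z' rz' fz'] := second_difference f (ltW s0) sr dfv dfvu.
rewrite [s *: v + (s *: u + x)]addrCA in fz'.
have zz' : 'D_v ('D_u f) z = 'D_u ('D_v f) z'.
  exact: eq_of_second_differences (lt0r_neq0 s0) fz fz'.
have [_ [zA _]] := near_x _ rz; have [_ [_ zB]] := near_x _ rz'.
by rewrite -zz' in zB; exact: dist_le_of_half zA zB.
Qed.

Section RowVectorValued.
Context {R : realType} {m : nat}.

Lemma derive_coord {E : normedModType R} {f : E -> 'rV[R]_m} {x v : E} k :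
  derivable f x v -> 'D_v f x 0 k = 'D_v (fun y => f y 0 k) x.
Proof. by move=> df; rewrite derive_mx// mxE. Qed.

Lemma near_derive_coord {E : normedModType R} {f : E -> 'rV[R]_m} {x v : E} k :
  (\forall y \near x, derivable f y v) ->
  \forall y \near x, 'D_v f y 0 k = 'D_v (fun z => f z 0 k) y.
Proof. by apply: filterS => y /(derive_coord k). Qed.

Lemma continuous_coord {T : topologicalType} {f : T -> 'rV[R]_m} {x : T} k :
  {for x, continuous f} -> {for x, continuous (fun y => f y 0 k)}.
Proof.
move=> fc; apply: (@continuous_comp _ _ _ f (fun M : 'rV[R]_m => M 0 k)) => //.
exact: coord_continuous.
Qed.

Lemma near_eq_continuous {T W : topologicalType}
    {f g : T -> W} {x : T} :
  (\forall y \near x, f y = g y) ->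
  {for x, continuous f} -> {for x, continuous g}.
Proof.
move=> fg fc; rewrite /prop_for /continuous_at -(nbhs_singleton fg).
by apply: cvg_trans fc; apply: near_eq_cvg; apply: filterS fg => y ->.
Qed.

(** Taking coordinates commutes with differentiation only where the derivative
    exists, so the reduction to coordinates is carried out near x. *)
Lemma schwarz (E : normedModType R) (f : E -> 'rV[R]_m) (x u v : E) :
  (\forall y \near x, [/\ derivable f y u, derivable f y v,
     derivable ('D_u f) y v & derivable ('D_v f) y u]) ->
  {for x, continuous ('D_v ('D_u f))} -> {for x, continuous ('D_u ('D_v f))} ->
  'D_v ('D_u f) x = 'D_u ('D_v f) x.
Proof.
move=> df cvu cuv.
have mixed w w' k : (\forall y \near x, derivable f y w) ->
    (\forall y \near x, derivable ('D_w f) y w') ->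
  (\forall y \near x, derivable ('D_w (fun z => f z 0 k)) y w') /\
  (\forall y \near x, 'D_w' ('D_w f) y 0 k = 'D_w' ('D_w (fun z => f z 0 k)) y).
  move=> dw dww'.
  have /near_join fw := near_derive_coord k dw.
  split.
    near=> y.
    apply: near_eq_derivable (_ : derivable (fun z => 'D_w f z 0 k) y w').
      by apply: filterS (near fw y _) => // z ->.
    have /derivable_mxP : derivable ('D_w f) y w' by near: y.
    exact.
  near=> y.
  rewrite derive_coord; last by near: y.
  apply: near_eq_derive.
  by apply: filterS (near fw y _) => // z ->.
have dfu : \forall y \near x, derivable f y u by apply: filterS df => y [].
have dfv : \forall y \near x, derivable f y v by apply: filterS df => y [].
have dfuv : \forall y \near x, derivable ('D_u f) y v by apply: filterS df => y [].
have dfvu : \forall y \near x, derivable ('D_v f) y u by apply: filterS df => y [].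
apply/rowP => k.
have [duv euv] := mixed u v k dfu dfuv; have [dvu evu] := mixed v u k dfv dfvu.
have euvx : 'D_v ('D_u f) x 0 k = 'D_v ('D_u (fun z => f z 0 k)) x.
  exact: nbhs_singleton euv.
have evux : 'D_u ('D_v f) x 0 k = 'D_u ('D_v (fun z => f z 0 k)) x.
  exact: nbhs_singleton evu.
refine (etrans euvx (etrans _ (esym evux))).
apply: schwarz_scalar.
- apply: filterS (filterI (filterI dfu dfv) (filterI duv dvu)).
  move=> y [[/derivable_mxP dyu /derivable_mxP dyv] [dyuv dyvu]].
  by split; [exact: dyu|exact: dyv|exact: dyuv|exact: dyvu].
- exact: (near_eq_continuous euv (continuous_coord k cvu)).
- exact: (near_eq_continuous evu (continuous_coord k cuv)).
Unshelve. all: by end_near. Qed.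

Lemma differentiable_C1_rV (n : nat) (f : 'rV[R]_n -> 'rV[R]_m)
    (x : 'rV[R]_n) :
  (forall j, \forall y \near x, derivable f y (basis_vec j)) ->
  (forall j, {for x, continuous ('D_(basis_vec j) f)}) ->
  differentiable f x.
Proof.
move=> df cf.
have fE : f = \sum_k (fun y => f y 0 k *: delta_mx 0 k).
  by apply/funext => y; rewrite fct_sumE [LHS]row_sum_delta.
rewrite fE; apply: differentiable_sum => k; apply: differentiableZl.
apply: differentiable_C1 => j.
  apply: filterS (df j) => y /derivable_mxP; exact.
exact: (near_eq_continuous (near_derive_coord k (df j))
  (continuous_coord k (cf j))).
Qed.

End RowVectorValued.

(** * Hyperbolic functions *)

Definition cosh {R : realType} (t : R) : R := (expR t + expR (- t)) / 2.
Definition sinh {R : realType} (t : R) : R := (expR t - expR (- t)) / 2.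

Section HyperbolicFunctions.
Context {R : realType}.
Implicit Types s t : R.

Lemma cosh0 : cosh 0 = 1 :> R.
Proof. by rewrite /cosh oppr0 expR0; field. Qed.

Lemma sinh0 : sinh 0 = 0 :> R.
Proof. by rewrite /sinh oppr0 subrr mul0r. Qed.

Lemma cosh2Bsinh2 t : cosh t ^+ 2 - sinh t ^+ 2 = 1.
Proof.
transitivity (expR t * expR (- t)); first by rewrite /cosh /sinh; field.
by rewrite expRN divff// gt_eqF// expR_gt0.
Qed.

Lemma is_derive_expR_linear t s :
  is_derive s 1 (fun u => expR (t * u)) (t * expR (t * s)).
Proof.
rewrite mulrC; apply: (@is_derive1_comp R expR (fun u => t * u)).
by apply: is_derive_eq (is_deriveZ t (is_derive_id s 1)) _; rewrite [LHS]mulr1.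
Qed.

Lemma is_derive_cosh_linear t s :
  is_derive s 1 (fun u => cosh (t * u)) (t * sinh (t * s)).
Proof.
have dN : is_derive s 1 (fun u => expR (- (t * u))) (- t * expR (- (t * s))).
  rewrite -mulNr (_ : (fun u => _) = fun u => expR (- t * u)).
    exact: is_derive_expR_linear.
  by apply/funext => u; rewrite mulNr.
have := is_deriveZ (2^-1 : R) (is_deriveD (is_derive_expR_linear t s) dN).
rewrite (_ : _ \*: _ = fun u => cosh (t * u)); last first.
  by apply/funext => u; rewrite /cosh mulrC.
by move=> /is_derive_eq; apply; rewrite /sinh/= /GRing.scale/=; field.
Qed.

Lemma is_derive_sinh_linear t s :
  is_derive s 1 (fun u => sinh (t * u)) (t * cosh (t * s)).
Proof.
have dN : is_derive s 1 (fun u => expR (- (t * u))) (- t * expR (- (t * s))).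
  rewrite -mulNr (_ : (fun u => _) = fun u => expR (- t * u)).
    exact: is_derive_expR_linear.
  by apply/funext => u; rewrite mulNr.
have := is_deriveZ (2^-1 : R) (is_deriveB (is_derive_expR_linear t s) dN).
rewrite (_ : _ \*: _ = fun u => sinh (t * u)); last first.
  by apply/funext => u; rewrite /sinh mulrC.
by move=> /is_derive_eq; apply; rewrite /cosh/= /GRing.scale/=; field.
Qed.

End HyperbolicFunctions.

Lemma is_derive_cosh {R : realType} (t : R) : is_derive t 1 cosh (sinh t).
Proof.
have := is_derive_cosh_linear 1 t; rewrite !mul1r.
by rewrite (_ : (fun u => _) = cosh)//; apply/funext => u; rewrite mul1r.
Qed.

Lemma is_derive_sinh {R : realType} (t : R) : is_derive t 1 sinh (cosh t).
Proof.
have := is_derive_sinh_linear 1 t; rewrite !mul1r.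
by rewrite (_ : (fun u => _) = sinh)//; apply/funext => u; rewrite mul1r.
Qed.

Lemma is_derive_scalel {R : realFieldType} {E W : normedModType R} {k : E -> R}
    (w : W) {x v : E} {dk : R} :
  is_derive x v k dk -> is_derive x v (fun y => k y *: w) (dk *: w).
Proof.
move=> [dkx <-].
have quotE : (fun h : R => h^-1 *: (((fun y => k y *: w) \o shift x) (h *: v)
      - k x *: w)) =
    (fun h => (h^-1 *: ((k \o shift x) (h *: v) - k x)) *: w).
  by apply/funext => h /=; rewrite -scalerBl scalerA.
have lim_quot : (fun h : R => h^-1 *: (((fun y => k y *: w) \o shift x) (h *: v)
      - k x *: w)) @ 0^' --> 'D_v k x *: w.
  by rewrite quotE; apply: cvgZr_tmp; exact: dkx.
by split; [apply/cvg_ex; exists ('D_v k x *: w)|exact/cvg_lim].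
Qed.

Lemma is_derive_row2 {R : realFieldType} {E W : normedModType R}
    {k l : E -> R} (u w : W) {x v : E} {dk dl : R} :
  is_derive x v k dk -> is_derive x v l dl ->
  is_derive x v (fun y => k y *: u + l y *: w) (dk *: u + dl *: w).
Proof. by move=> dk' dl'; apply: is_deriveD; exact: is_derive_scalel. Qed.

Lemma is_derive_is_derive1 {R : numFieldType} {W : normedModType R}
    (f : R -> W) (x : R) (df : W) : is_derive x 1 f df -> derive1 f x = df.
Proof. by move=> [_ <-]; rewrite derive1E. Qed.

(** Factor the equation f'' = t^2 f as (d - t)(d + t) f = 0 and integrate the
    two first-order factors in turn. This also covers t = 0. *)
Lemma second_order_linear_ode0 {R : realType} (f g : R -> R) (t : R) :
  (forall s : R, is_derive s 1 f (g s)) ->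
  (forall s : R, is_derive s 1 g (t ^+ 2 * f s)) ->
  f 0 = 0 -> g 0 = 0 -> forall s, f s = 0.
Proof.
move=> df dg f0 g0.
have gf s : g s + t * f s = 0.
  have : expR (- t * s) * (g s + t * f s) = expR (- t * 0) * (g 0 + t * f 0).
    apply: (@is_derive_0_is_cst _ (fun s => expR (- t * s) * (g s + t * f s))).
    move=> u; have := is_deriveM (is_derive_expR_linear (- t) u)
      (is_deriveD (dg u) (is_deriveZ t (df u))).
    move=> /is_derive_eq; apply.
    by rewrite (_ : (g + t \*: f) u = g u + t * f u)// /GRing.scale/=; ring.
  rewrite g0 f0 !mulr0 add0r mulr0 => /eqP; rewrite mulf_eq0 gt_eqF ?expR_gt0//=.
  by move/eqP.
move=> s; have : expR (t * s) * f s = expR (t * 0) * f 0.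
  apply: (@is_derive_0_is_cst _ (fun s => expR (t * s) * f s)) => u.
  have := is_deriveM (is_derive_expR_linear t u) (df u).
  move=> /is_derive_eq; apply; rewrite /GRing.scale/=.
  by rewrite -[RHS](mulr0 (expR (t * u))) -(gf u); ring.
rewrite f0 mulr0 => /eqP; rewrite mulf_eq0 gt_eqF ?expR_gt0//=.
by move/eqP.
Qed.

(** * Geodesics of the hyperboloid *)

Section Geodesics.
Context {R : realType} {m : nat}.
Implicit Types (p v w : 'rV[R]_m.+1) (gam : R -> 'rV[R]_m.+1).

Lemma minkDl u v w : mink (u + v) w = mink u w + mink v w.
Proof. by rewrite minkC minkDr ![mink w _]minkC. Qed.

Lemma minkZl a u v : mink (a *: u) v = a * mink u v.
Proof. by rewrite minkC minkZr minkC. Qed.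

Definition hyp_geodesic p v (t s : R) := cosh (t * s) *: p + sinh (t * s) *: v.
(** Normalized so that t times it is the derivative of [hyp_geodesic p v t],
    also for t = 0. *)
Definition hyp_velocity p v (t s : R) := cosh (t * s) *: v + sinh (t * s) *: p.

Lemma is_derive_hyp_geodesic p v (t s : R) :
  is_derive s 1 (hyp_geodesic p v t) (t *: hyp_velocity p v t s).
Proof.
have := is_derive_row2 p v (is_derive_cosh_linear t s)
  (is_derive_sinh_linear t s).
by move=> /is_derive_eq; apply; rewrite /hyp_velocity scalerDr !scalerA addrC.
Qed.

Lemma is_derive_hyp_velocity p v (t s : R) :
  is_derive s 1 (hyp_velocity p v t) (t *: hyp_geodesic p v t s).
Proof. exact: (is_derive_hyp_geodesic v p). Qed.

Lemma derive1_hyp_geodesic p v (t : R) :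
  derive1 (hyp_geodesic p v t) = fun s => t *: hyp_velocity p v t s.
Proof.
by apply/funext => s; apply: is_derive_is_derive1; exact: is_derive_hyp_geodesic.
Qed.

(** The vector p_0 v - v_0 p has no time component, so its Minkowski square,
    which is p_0^2 - v_0^2, is nonnegative. This is what keeps the hyperbolic
    rotation of p and v on the upper sheet. *)
Lemma unit_tangent_time_le {p v} : 0 < p 0 0 ->
  mink p p = -1 -> mink p v = 0 -> mink v v = 1 -> `|v 0 0| <= p 0 0.
Proof.
move=> p0 pp pv vv.
pose w := p 0 0 *: v - v 0 0 *: p.
have ww : mink w w = p 0 0 ^+ 2 - v 0 0 ^+ 2.
  rewrite /w -scaleNr !(minkDl, minkDr, minkZl, minkZr) [mink v p]minkC pp pv vv.
  by ring.
have : 0 <= mink w w.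
  have w0 : w 0 0 = 0 by rewrite !mxE [X in _ - X]mulrC subrr.
  rewrite /mink w0 mul0r oppr0 add0r.
  by apply: sumr_ge0 => k _; rewrite -expr2 sqr_ge0.
by rewrite ww subr_ge0 -ler_sqrt ?sqr_ge0// sqrtr_sqr [leRHS]sqrtr_sqr (gtr0_norm p0).
Qed.

Lemma hyp_geodesic_hyperboloid {p v} (t s : R) : hyperboloid p -> tangent p v ->
  mink v v = 1 -> hyperboloid (hyp_geodesic p v t s).
Proof.
move=> [pp p0] pv vv; rewrite /tangent/= in pv.
split; rewrite /hyp_geodesic.
  rewrite !(minkDl, minkDr, minkZl, minkZr) [mink v p]minkC pp pv vv.
  by apply: etrans (congr1 -%R (cosh2Bsinh2 (t * s))); ring.
have := unit_tangent_time_le p0 pp pv vv; rewrite ler_norml => /andP[v1 v2].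
rewrite !mxE /cosh /sinh.
have := expR_gt0 (t * s); have := expR_gt0 (- (t * s)).
set e := expR _; set e' := expR _ => e'0 e0.
rewrite (_ : _ + _ = (e' * (p 0 0 + v 0 0) + e * (p 0 0 - v 0 0)) / 2); last by field.
rewrite divr_gt0//.
have [v0|v0] := leP 0 (v 0 0).
  have [sum0 dif0] : 0 < p 0 0 + v 0 0 /\ 0 <= p 0 0 - v 0 0 by split; lra.
  by rewrite ltr_pwDl ?mulr_gt0// mulr_ge0// ltW.
have [sum0 dif0] : 0 <= p 0 0 + v 0 0 /\ 0 < p 0 0 - v 0 0 by split; lra.
by rewrite ltr_wpDl ?mulr_gt0// mulr_ge0// ltW.
Qed.

Lemma is_geodesic_hyp_geodesic {p v} (t : R) : hyperboloid p -> tangent p v ->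
  mink v v = 1 -> is_geodesic (hyp_geodesic p v t).
Proof.
move=> hp tv vv.
have d2 (s : R) : is_derive s 1 (derive1 (hyp_geodesic p v t))
    (t ^+ 2 *: hyp_geodesic p v t s).
  rewrite derive1_hyp_geodesic expr2 -scalerA.
  exact: is_deriveZ (is_derive_hyp_velocity p v t s).
have hyp s := hyp_geodesic_hyperboloid t s hp tv vv.
split=> // s; first by have [] := is_derive_hyp_geodesic p v t s.
rewrite /hcov; have [_ ->] := d2 s.
by rewrite /tproj minkZr; have [-> _] := hyp s; rewrite mulrN1 scaleNr subrr.
Qed.

(** Differentiating <gam, gam> = -1 twice gives <gam, gam''> = - <gam', gam'>,
    so the geodesic equation reads gam'' = <gam', gam'> gam; the speed is
    constant because gam' is orthogonal to gam. *)
Lemma geodesic_acceleration {gam} : is_geodesic gam -> forall s : R,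
  is_derive s 1 (derive1 gam) (mink (derive1 gam 0) (derive1 gam 0) *: gam s).
Proof.
move=> [hyp d1 d2 cov0].
have D2 s := derivableP (d2 s).
set acc := fun s => 'D_1 (derive1 gam) s in D2.
have orth s : mink (gam s) (derive1 gam s) = 0.
  have [_ dE] := is_derive_mink (d1 s) (d1 s).
  move: dE; rewrite (_ : (fun y => _) = cst (-1)); last first.
    by apply/funext => y; have [-> _] := hyp y.
  rewrite derive_cst -!derive1E minkC -mulr2n => /esym/eqP.
  by rewrite mulrn_eq0/= => /eqP.
have accE s : acc s = mink (derive1 gam s) (derive1 gam s) *: gam s.
  have [_ dE] := is_derive_mink (d1 s) (d2 s).
  move: dE; rewrite (_ : (fun y => _) = cst 0); last by apply/funext => y.
  rewrite derive_cst -derive1E -/(acc s) => /esym/eqP; rewrite addr_eq0 => /eqP ->.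
  have := cov0 s; rewrite /hcov /tproj -/(acc s) => /eqP.
  by rewrite addr_eq0 -scaleNr => /eqP.
have speed s : mink (derive1 gam s) (derive1 gam s) =
    mink (derive1 gam 0) (derive1 gam 0).
  apply: (@is_derive_0_is_cst _ (fun s => mink (derive1 gam s) (derive1 gam s))).
  move=> u; apply: is_derive_eq (is_derive_mink (d2 u) (d2 u)) _.
  by rewrite -/(acc u) accE minkZl minkZr orth minkC orth mulr0 addr0.
by move=> s; rewrite -(speed s) -accE; exact: D2.
Qed.

Lemma geodesic_unique {gam p v} {t : R} : is_geodesic gam -> mink v v = 1 ->
  gam 0 = p -> derive1 gam 0 = t *: v -> gam = hyp_geodesic p v t.
Proof.
move=> geo vv gam0 dgam0; apply/funext => s; apply/rowP => k.
have [_ d1 _ _] := geo.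
have D2 (u : R) : is_derive u 1 (derive1 gam) (t ^+ 2 *: gam u).
  have := geodesic_acceleration geo u.
  by rewrite dgam0 minkZl minkZr vv mulr1 expr2.
have coord (F : R -> 'rV[R]_m.+1) (u : R) dF : is_derive u 1 F dF ->
    is_derive u 1 (fun y => F y 0 k) (dF 0 k).
  move=> [dFu <-]; rewrite derive_mx// mxE; apply: derivableP.
  by move/derivable_mxP : dFu; apply.
apply/eqP; rewrite -subr_eq0; apply/eqP.
apply: (@second_order_linear_ode0 _
  (fun s => gam s 0 k - hyp_geodesic p v t s 0 k)
  (fun s => derive1 gam s 0 k - (t *: hyp_velocity p v t s) 0 k) t).
- move=> u; apply: is_deriveB; apply: coord; last exact: is_derive_hyp_geodesic.
  by rewrite derive1E; apply: derivableP.
- move=> u; have := is_deriveB (coord _ _ _ (D2 u))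
    (coord _ _ _ (is_deriveZ t (is_derive_hyp_velocity p v t u))).
  by move=> /is_derive_eq; apply; rewrite !mxE; ring.
- by rewrite gam0 !mxE mulr0 cosh0 sinh0; ring.
- by rewrite dgam0 !mxE mulr0 cosh0 sinh0; ring.
Qed.

Lemma psiE {p v} (t : R) : hyperboloid p -> tangent p v -> mink v v = 1 ->
  psi t p v = cosh t *: p + sinh t *: v.
Proof.
move=> hp tv vv; have -> : cosh t *: p + sinh t *: v = hyp_geodesic p v t 1.
  by rewrite /hyp_geodesic mulr1.
rewrite /psi /hexp; case: xgetP => [q _ [gam [geo gam0 dgam0 <-]]|].
  by rewrite (geodesic_unique geo vv gam0 dgam0).
move=> /(_ (hyp_geodesic p v t 1)); case.
exists (hyp_geodesic p v t); split=> //.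
- exact: is_geodesic_hyp_geodesic.
- by rewrite /hyp_geodesic mulr0 cosh0 sinh0 scale1r scale0r addr0.
- by rewrite derive1_hyp_geodesic /hyp_velocity mulr0 cosh0 sinh0 scale1r scale0r addr0.
Qed.

End Geodesics.

(** * Derivatives of matrix-valued curves *)

Lemma is_derive_mxP {R : realFieldType} {E : normedModType R} {m n : nat}
    (M : E -> 'M[R]_(m, n)) (x v : E) (dM : 'M[R]_(m, n)) :
  is_derive x v M dM <->
  forall i j, is_derive x v (fun y => M y i j) (dM i j).
Proof.
split=> [[Mx <-] i j|dMij].
  rewrite derive_mx// mxE; apply: derivableP.
  by move/derivable_mxP : Mx; apply.
have Mx : derivable M x v by apply/derivable_mxP => i j; have [] := dMij i j.
split; first exact: Mx.
rewrite derive_mx//; apply/matrixP => i j; rewrite mxE.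
by have [] := dMij i j.
Qed.

Section MatrixCalculus.
Context {R : realFieldType} {E : normedModType R}.
Implicit Types x v : E.

Lemma is_derive_bigsum {I : Type} (r : seq I) {F : I -> E -> R} {dF : I -> R}
    {x v} : (forall i, is_derive x v (F i) (dF i)) ->
  is_derive x v (fun y => \sum_(i <- r) F i y) (\sum_(i <- r) dF i).
Proof.
move=> dFi; elim: r => [|i r IH].
  rewrite big_nil (_ : (fun _ => _) = cst 0); first exact: is_derive_cst.
  by apply/funext => y; rewrite big_nil.
rewrite big_cons (_ : (fun _ => _) = F i + fun y => \sum_(j <- r) F j y).
  exact: is_deriveD (dFi i) IH.
by apply/funext => y; rewrite big_cons.
Qed.

Lemma derivable_bigprod {I : Type} (r : seq I) {F : I -> E -> R} {x v} :
  (forall i, derivable (F i) x v) ->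
  derivable (fun y => \prod_(i <- r) F i y) x v.
Proof.
move=> dF; elim: r => [|i r IH].
  rewrite (_ : (fun _ => _) = cst 1); first exact: derivable_cst.
  by apply/funext => y; rewrite big_nil.
rewrite (_ : (fun _ => _) = F i * fun y => \prod_(j <- r) F j y).
  exact: derivableM (dF i) IH.
by apply/funext => y; rewrite big_cons.
Qed.

Lemma is_derive_mulmx {m n p : nat} {A : E -> 'M[R]_(m, n)}
    {B : E -> 'M[R]_(n, p)} {x v : E} {dA dB} :
  is_derive x v A dA -> is_derive x v B dB ->
  is_derive x v (fun y => A y *m B y) (dA *m B x + A x *m dB).
Proof.
move=> /is_derive_mxP dAij /is_derive_mxP dBij; apply/is_derive_mxP => i j.
rewrite (_ : (fun y => _) = fun y => \sum_k A y i k * B y k j); last first.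
  by apply/funext => y; rewrite mxE.
rewrite !mxE -big_split/=; apply: is_derive_bigsum => k.
have := is_deriveM (dAij i k) (dBij k j).
by move=> /is_derive_eq; apply; rewrite /GRing.scale/= addrC [B x k j * _]mulrC.
Qed.

Lemma is_derive_trmx {m n : nat} {A : E -> 'M[R]_(m, n)} {x v : E} {dA} :
  is_derive x v A dA -> is_derive x v (fun y => (A y)^T) dA^T.
Proof.
move=> /is_derive_mxP dAij; apply/is_derive_mxP => i j; rewrite mxE.
rewrite (_ : (fun y => _) = fun y => A y j i); first exact: dAij.
by apply/funext => y; rewrite mxE.
Qed.

(** The Leibniz formula is a polynomial in the entries. *)
Lemma derivable_det {n : nat} {A : E -> 'M[R]_n} {x v : E} :
  derivable A x v -> derivable (fun y => \det (A y)) x v.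
Proof.
move=> /derivable_mxP dA.
have dterm (s : 'S_n) : derivable (fun y => \prod_k A y k (s k)) x v.
  by apply: derivable_bigprod => k; exact: dA.
by have [] := is_derive_bigsum (index_enum _)
  (fun s : 'S_n => is_deriveZ ((-1) ^+ s : R) (derivableP (dterm s))).
Qed.

End MatrixCalculus.

(** Derivability comes from the formula det^-1 adj, valid near t as the
    determinant is continuous; the value then follows by differentiating
    A A^-1 = 1. *)
Lemma is_derive_invmx {R : realType} {n : nat} {A : R -> 'M[R]_n} {t : R} {dA} :
  A t \in unitmx -> is_derive t 1 A dA ->
  is_derive t 1 (fun s => invmx (A s)) (- (invmx (A t) *m dA *m invmx (A t))).
Proof.
move=> At dAt; have Ader : derivable A t 1 by case: dAt.
have detA : derivable (fun s => \det (A s)) t 1 by exact: derivable_det.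
have det0 : \det (A t) != 0 by rewrite -unitfE -unitmxE.
have near_unit : \forall s \near t, A s \in unitmx.
  have detc : {for t, continuous (fun s => \det (A s))}.
    by apply: differentiable_continuous; exact/derivable1_diffP.
  have nz : \forall s \near t, \det (A s) != 0.
    exact: (@cvgr_neq0 _ _ _ (nbhs t) _ _ _ detc det0).
  by apply: filterS nz => s; rewrite unitmxE unitfE.
have invA : derivable (fun s => invmx (A s)) t 1.
  apply: (@near_eq_derivable _ _ _ (fun s => (\det (A s))^-1 *: \adj (A s))).
    by apply: filterS near_unit => s As; rewrite /invmx As.
  apply/derivable_mxP => i j.
  rewrite (_ : (fun s => _) = (fun s => (\det (A s))^-1) *
    ((-1) ^+ (j + i) \*: (fun s => \det (row' j (col' i (A s)))))); last first.
    by apply/funext => s; rewrite !mxE.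
  apply: derivableM; first exact: derivableV.
  apply: derivableZ; apply: derivable_det; apply/derivable_mxP => k l.
  rewrite (_ : (fun s => _) = fun s => A s (lift j k) (lift i l)); last first.
    by apply/funext => s; rewrite !mxE.
  by move/derivable_mxP : Ader.
have dI := derivableP invA; set dB := 'D_1 _ t in dI.
have [_ d1] := is_derive_mulmx dAt dI.
have : 'D_1 (fun s => A s *m invmx (A s)) t = 0.
  rewrite (_ : 0 = 'D_1 (cst 1%:M : R -> 'M[R]_n) t); last by rewrite derive_cst.
  by apply: near_eq_derive; apply: filterS near_unit => s; exact: mulmxV.
rewrite d1 => /(congr1 (mulmx (invmx (A t)))).
rewrite mulmx0 mulmxDr mulKmx// mulmxA => /eqP; rewrite addrC addr_eq0 => /eqP dBE.
by rewrite -dBE.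
Qed.

(** With B = G^-1, the product rule gives
    (B P)' = 2 B P B P - B (P B P + G) = (B P)^2 - 1. *)
Lemma riccati {R : realType} {n : nat} {G P : R -> 'M[R]_n} {t : R} :
  G t \in unitmx -> is_derive t 1 G (- 2 *: P t) ->
  is_derive t 1 P (- (P t *m invmx (G t) *m P t) - G t) ->
  is_derive t 1 (fun s => invmx (G s) *m P s)
    ((invmx (G t) *m P t) *m (invmx (G t) *m P t) - 1%:M).
Proof.
move=> Gt dG dP.
have := is_derive_mulmx (is_derive_invmx Gt dG) dP.
move=> /is_derive_eq; apply.
rewrite mulmxBr mulVmx// mulmxN -scalemxAr -scalemxAl scaleNr opprK.
rewrite -!scalemxAl !mulmxA scaler_nat mulr2n addrA; congr (_ - _).
by rewrite addrK.
Qed.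

(** * Gram matrices in Minkowski space *)

Section Gram.
Context {R : realType} {m : nat}.
Implicit Types (u v : 'rV[R]_m.+1).

Definition lorentz : 'M[R]_m.+1 :=
  diag_mx (\row_k (if k == 0 then -1 else 1)).

(** Gathering the Minkowski products of all pairs of rows in a matrix turns the
    index computations with the fundamental forms into matrix algebra. *)
Definition gram {k l : nat} (A : 'M[R]_(k, m.+1)) (B : 'M[R]_(l, m.+1)) :
  'M[R]_(k, l) := A *m lorentz *m B^T.

Lemma gramE {k l : nat} (A : 'M[R]_(k, m.+1)) (B : 'M[R]_(l, m.+1)) i j :
  gram A B i j = mink (row i A) (row j B).
Proof.
rewrite /gram mul_mx_diag mxE big_ord_recl /mink !mxE eqxx mulrN1 mulNr.
congr (_ + _); apply: eq_bigr => c _.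
by rewrite !mxE mulr1.
Qed.

Lemma gram_tr {k l : nat} (A : 'M[R]_(k, m.+1)) (B : 'M[R]_(l, m.+1)) :
  (gram A B)^T = gram B A.
Proof. by apply/matrixP => i j; rewrite mxE !gramE minkC. Qed.

Lemma is_derive_gram {E : normedModType R} {k l : nat}
    {A : E -> 'M[R]_(k, m.+1)} {B : E -> 'M[R]_(l, m.+1)} {x v : E} {dA dB} :
  is_derive x v A dA -> is_derive x v B dB ->
  is_derive x v (fun y => gram (A y) (B y)) (gram dA (B x) + gram (A x) dB).
Proof.
move=> dAx dBx.
have := is_derive_mulmx (is_derive_mulmx dAx (is_derive_cst lorentz x v))
  (is_derive_trmx dBx).
by move=> /is_derive_eq; apply; rewrite mulmx0 addr0.
Qed.

Lemma gram_col_mxl {k k' l : nat} (A : 'M[R]_(k, m.+1)) (B : 'M[R]_(k', m.+1))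
    (C : 'M[R]_(l, m.+1)) :
  gram (col_mx A B) C = col_mx (gram A C) (gram B C).
Proof. by rewrite /gram !mul_col_mx. Qed.

Lemma gram_col_mxr {k k' l : nat} (A : 'M[R]_(k, m.+1)) (B : 'M[R]_(k', m.+1))
    (C : 'M[R]_(l, m.+1)) :
  gram C (col_mx A B) = row_mx (gram C A) (gram C B).
Proof. by rewrite /gram tr_col_mx mul_mx_row. Qed.

Lemma gram_subr_mull {k l h : nat} (A : 'M[R]_(l, m.+1)) (Y : 'M[R]_(k, m.+1))
    (M : 'M[R]_(k, h)) (X : 'M[R]_(h, m.+1)) :
  gram A (Y - M *m X) = gram A Y - gram A X *m M^T.
Proof. by rewrite /gram linearB/= mulmxBr trmx_mul mulmxA. Qed.

Lemma gram_row (u v : 'rV[R]_m.+1) : gram u v = (mink u v)%:M.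
Proof. by apply/matrixP => i j; rewrite !ord1 gramE !row_id mxE eqxx mulr1n. Qed.

(** If Z lorentz Z^T is invertible, so is the square matrix Z lorentz, which
    annihilates W^T. The number of rows of Z is only assumed equal to m.+1, so
    that Z may be a block matrix of height 1 + 1 + n. *)
Lemma gram_nondegenerate {k l : nat} (Z : 'M[R]_(k, m.+1))
    (W : 'M[R]_(l, m.+1)) :
  k = m.+1 -> gram Z Z \in unitmx -> gram Z W = 0 -> W = 0.
Proof.
move=> km; subst k.
rewrite /gram unitmx_mul => /andP[uZ _] ZW; apply: trmx_inj.
by rewrite trmx0 -(mulKmx uZ W^T) ZW mulmx0.
Qed.

End Gram.

(** The Gram matrix of p, q and the rows of X is block diagonal with blocks
    diag(-1, 1) and gram X X, so these n+2 vectors form a basis. The matrix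
    Y - (gram Y X)(gram X X)^-1 X is orthogonal to all of them, hence zero. *)
Lemma gram_span {R : realType} {n k : nat} (p q : 'rV[R]_n.+2)
    (X : 'M[R]_(n, n.+2)) (Y : 'M[R]_(k, n.+2)) :
  mink p p = -1 -> mink q q = 1 -> mink p q = 0 ->
  gram p X = 0 -> gram q X = 0 -> gram p Y = 0 -> gram q Y = 0 ->
  gram X X \in unitmx ->
  gram Y Y = gram Y X *m invmx (gram X X) *m gram X Y.
Proof.
move=> pp qq pq pX qX pY qY uG.
pose M := gram Y X *m invmx (gram X X).
have YE : Y = M *m X.
  apply/eqP; rewrite -subr_eq0; apply/eqP.
  apply: (gram_nondegenerate (col_mx (col_mx p q) X)) => //.
    have pqX : gram (col_mx p q) X = 0 by rewrite gram_col_mxl pX qX col_mx0.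
    rewrite (gram_col_mxl _ X) !(gram_col_mxr _ X) pqX.
    rewrite -(gram_tr (col_mx p q) X) pqX trmx0 -/(block_mx _ _ _ _).
    rewrite unitmxE det_ublock unitrM -[X in _ && X]unitmxE uG andbT.
    rewrite gram_col_mxl !gram_col_mxr !gram_row pp qq (minkC q p) pq raddf0.
    rewrite -/(block_mx _ _ _ _) det_ublock det1 mulr1 det_scalar expr1.
    exact: unitrN1.
  rewrite !gram_col_mxl !gram_subr_mull pX qX pY qY !mul0mx !subr0.
  rewrite /M trmx_mul trmx_inv !gram_tr mulKVmx// subrr.
  by rewrite !col_mx0.
rewrite {2}YE {1}/gram trmx_mul mulmxA -/(gram Y X).
by rewrite /M trmx_mul trmx_inv !gram_tr mulmxA.
Qed.

Lemma mink_derive_of_const {R : realType} {m : nat} {E : normedModType R}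
    {F H : E -> 'rV[R]_m.+1} {x v : E} (c : R) :
  (\forall y \near x, mink (F y) (H y) = c) ->
  derivable F x v -> derivable H x v ->
  mink ('D_v F x) (H x) = - mink (F x) ('D_v H x).
Proof.
move=> FHc dF dH; apply/eqP; rewrite -addr_eq0; apply/eqP.
have [_ <-] := is_derive_mink dF dH.
have cE : \forall y \near x, mink (F y) (H y) = cst c y by exact: FHc.
by rewrite (near_eq_derive _ cE) derive_cst.
Qed.

Lemma mink_comb {R : realType} {m : nat} (u v u' v' : 'rV[R]_m.+1) (a b a' b' : R) :
  mink (a *: u + b *: v) (a' *: u' + b' *: v') =
  a * a' * mink u u' + a * b' * mink u v' + b * a' * mink v u' +
  b * b' * mink v v'.
Proof. by rewrite !(minkDl, minkDr, minkZl, minkZr); ring. Qed.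

(** The hypotheses are the relations <D_k D_j F, H> = - <D_j F, D_k H> for F
    and H among i and N: here p, q are i, N, then u, v and u', v' are their
    first derivatives along j and k, and Dp, Dq their second derivatives. *)
Lemma mink_comb_by_parts {R : realType} {m : nat}
    {p q Dp Dq u v u' v' : 'rV[R]_m.+1} (c s : R) :
  mink Dp q = - mink u v' -> mink Dp p = - mink u u' ->
  mink Dq q = - mink v v' -> mink Dq p = - mink v u' ->
  mink (c *: Dp + s *: Dq) (s *: p + c *: q) =
  - mink (c *: u + s *: v) (s *: u' + c *: v').
Proof. by move=> pq pp qq qp; rewrite !mink_comb pq pp qq qp; ring. Qed.

Lemma mink_comb_sym {R : realType} {m : nat} {u v u' v' : 'rV[R]_m.+1} (c s : R) :
  mink u v' = mink v u' ->
  mink (s *: u + c *: v) (c *: u' + s *: v') =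
  mink (c *: u + s *: v) (s *: u' + c *: v').
Proof. by move=> uv; rewrite !mink_comb uv; ring. Qed.

Lemma row_comb {R : pzRingType} {k l : nat} (A B : 'M[R]_(k, l)) (a b : R) j :
  row j (a *: A + b *: B) = a *: row j A + b *: row j B.
Proof. by rewrite linearD !linearZ. Qed.

(** * Smooth maps on an open set *)

Section SmoothMaps.
Context {R : realType} {n m : nat} {U : set 'rV[R]_n}.
Context {f : 'rV[R]_n -> 'rV[R]_m}.
Implicit Types x : 'rV[R]_n.

Lemma smooth_derivable x j : smooth_on U f -> U x -> derivable f x (basis_vec j).
Proof. by move=> sf Ux; have [_] := sf [::] x Ux; apply. Qed.

Lemma smooth_derivable2 x j k : smooth_on U f -> U x ->
  derivable ('D_(basis_vec j) f) x (basis_vec k).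
Proof. by move=> sf Ux; have [_] := sf [:: j] x Ux; apply. Qed.

Lemma smooth_differentiable x : open U -> smooth_on U f -> U x ->
  differentiable f x.
Proof.
move=> oU sf Ux; apply: differentiable_C1_rV => j.
  by apply: filterS (open_nbhs_nbhs (conj oU Ux)) => y; exact: smooth_derivable.
by have [] := sf [:: j] x Ux.
Qed.

Lemma smooth_schwarz x j k : open U -> smooth_on U f -> U x ->
  'D_(basis_vec k) ('D_(basis_vec j) f) x =
  'D_(basis_vec j) ('D_(basis_vec k) f) x.
Proof.
move=> oU sf Ux; apply: schwarz.
- apply: filterS (open_nbhs_nbhs (conj oU Ux)) => y Uy.
  by split; [exact: smooth_derivable|exact: smooth_derivable|
    exact: smooth_derivable2|exact: smooth_derivable2].
- by have [] := sf [:: k; j] x Ux.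
- by have [] := sf [:: j; k] x Ux.
Qed.

End SmoothMaps.

(** * The parallel hypersurfaces *)

Section Parallel.
Context {R : realType} {n : nat} {U : set 'rV[R]_n}.
Context {i N : 'rV[R]_n -> 'rV[R]_n.+2}.
Context (openU : open U) (imm : smooth_immersion U i).
Context (nrm : unit_normal_field U i N).

Let si : smooth_on U i. Proof. by case: imm. Qed.
Let sN : smooth_on U N. Proof. by case: nrm. Qed.

Let nearU x : U x -> \forall y \near x, U y.
Proof. by move=> Ux; exact: (open_nbhs_nbhs (conj openU Ux)). Qed.

Let i_i x : U x -> mink (i x) (i x) = -1.
Proof. by case: imm => _ hyp _ /hyp[]. Qed.

Let i_N x : U x -> mink (i x) (N x) = 0.
Proof. by case: nrm => _ /[apply] -[]. Qed.

Let N_N x : U x -> mink (N x) (N x) = 1.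
Proof. by case: nrm => _ /[apply] -[]. Qed.

Local Notation e_ j := (basis_vec j).

Let Di_N x j : U x -> mink ('D_(e_ j) i x) (N x) = 0.
Proof.
move=> Ux; rewrite deriveE; last exact: smooth_differentiable openU si Ux.
by case: nrm => _ /(_ x Ux)[_ dN _]; exact: dN.
Qed.

Let D_const (F H : 'rV[R]_n -> 'rV[R]_n.+2) x j (c : R) :
  (forall y, U y -> mink (F y) (H y) = c) -> U x ->
  derivable F x (basis_vec j) -> derivable H x (basis_vec j) ->
  mink ('D_(e_ j) F x) (H x) = - mink (F x) ('D_(e_ j) H x).
Proof.
move=> FH Ux; apply: (mink_derive_of_const c).
by apply: filterS (nearU x Ux) => y; exact: FH.
Qed.

Let Di_i x j : U x -> mink ('D_(e_ j) i x) (i x) = 0.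
Proof.
move=> Ux; have di := smooth_derivable x j si Ux.
have := D_const i i x j (-1) i_i Ux di di.
by rewrite [mink (i x) _]minkC => /eqP; rewrite -addr_eq0 -mulr2n mulrn_eq0/= => /eqP.
Qed.

Let DN_N x j : U x -> mink ('D_(e_ j) N x) (N x) = 0.
Proof.
move=> Ux; have dN := smooth_derivable x j sN Ux.
have := D_const N N x j 1 N_N Ux dN dN.
by rewrite [mink (N x) _]minkC => /eqP; rewrite -addr_eq0 -mulr2n mulrn_eq0/= => /eqP.
Qed.

Let DN_i x j : U x -> mink ('D_(e_ j) N x) (i x) = 0.
Proof.
move=> Ux; have := D_const i N x j 0 i_N Ux (smooth_derivable x j si Ux)
  (smooth_derivable x j sN Ux).
by rewrite Di_N// [mink (i x) _]minkC => /esym/eqP; rewrite oppr_eq0 => /eqP.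
Qed.

(** <D_j i, D_k N> = - <D_k D_j i, N> is symmetric in j and k because mixed
    partial derivatives commute. *)
Let shape_sym x j k : U x ->
  mink ('D_(e_ j) i x) ('D_(e_ k) N x) = mink ('D_(e_ k) i x) ('D_(e_ j) N x).
Proof.
move=> Ux.
have swap j' k' : mink ('D_(e_ j') i x) ('D_(e_ k') N x) =
    - mink ('D_(e_ k') ('D_(e_ j') i) x) (N x).
  rewrite (D_const ('D_(e_ j') i) N x k' 0) ?opprK//.
  - by move=> y; exact: Di_N.
  - exact: smooth_derivable2 si Ux.
  - exact: smooth_derivable sN Ux.
refine (etrans (swap j k) (etrans _ (esym (swap k j)))).
exact: (congr1 (fun V : 'rV[R]_n.+2 => - mink V (N x))
  (smooth_schwarz x j k openU si Ux)).
Qed.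

Lemma parallelE t x : U x -> parallel i N t x = cosh t *: i x + sinh t *: N x.
Proof.
move=> Ux; rewrite /parallel psiE//; last exact: N_N.
  by case: imm => _ hyp _; exact: hyp.
exact: i_N.
Qed.

Lemma normal_fieldE t x : U x ->
  normal_field i N t x = sinh t *: i x + cosh t *: N x.
Proof.
move=> Ux; rewrite /normal_field.
rewrite (_ : (fun s => _) = fun s => cosh s *: i x + sinh s *: N x); last first.
  by apply/funext => s; exact: parallelE.
apply: is_derive_is_derive1.
exact: is_derive_row2 (is_derive_cosh t) (is_derive_sinh t).
Qed.

Lemma derive_comb (F H : 'rV[R]_n -> 'rV[R]_n.+2) (a b : R) x v :
  derivable F x v -> derivable H x v ->
  'D_v (fun y => a *: F y + b *: H y) x = a *: 'D_v F x + b *: 'D_v H x.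
Proof.
move=> dF dH.
have := is_deriveD (is_deriveZ a (derivableP dF)) (is_deriveZ b (derivableP dH)).
by case.
Qed.

Lemma coord_fieldE t j x : U x ->
  coord_field i N t j x = cosh t *: 'D_(e_ j) i x + sinh t *: 'D_(e_ j) N x.
Proof.
move=> Ux; rewrite /coord_field.
have pE : \forall y \near x, parallel i N t y = cosh t *: i y + sinh t *: N y.
  by apply: filterS (nearU x Ux) => y; exact: parallelE.
rewrite (near_eq_derive _ pE) derive_comb//.
  exact: smooth_derivable si Ux.
exact: smooth_derivable sN Ux.
Qed.

Lemma derive_coord_fieldE t j k x : U x ->
  'D_(e_ k) (coord_field i N t j) x =
  cosh t *: 'D_(e_ k) ('D_(e_ j) i) x + sinh t *: 'D_(e_ k) ('D_(e_ j) N) x.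
Proof.
move=> Ux.
have pE : \forall y \near x, coord_field i N t j y =
    cosh t *: 'D_(e_ j) i y + sinh t *: 'D_(e_ j) N y.
  by apply: filterS (nearU x Ux) => y; exact: coord_fieldE.
rewrite (near_eq_derive _ pE) derive_comb//.
  exact: smooth_derivable2 si Ux.
exact: smooth_derivable2 sN Ux.
Qed.

(** The rows of [frame x t] are the coordinate fields D_j (parallel t), those
    of [dframe x t] the coordinate derivatives of the normal field; these two
    matrices are time derivatives of each other. *)
Definition frame (x : 'rV[R]_n) (t : R) : 'M[R]_(n, n.+2) :=
  cosh t *: (\matrix_j 'D_(e_ j) i x) + sinh t *: (\matrix_j 'D_(e_ j) N x).

Definition dframe (x : 'rV[R]_n) (t : R) : 'M[R]_(n, n.+2) :=
  sinh t *: (\matrix_j 'D_(e_ j) i x) + cosh t *: (\matrix_j 'D_(e_ j) N x).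

Let row_frame x t j :
  row j (frame x t) = cosh t *: 'D_(e_ j) i x + sinh t *: 'D_(e_ j) N x.
Proof. by rewrite row_comb !rowK. Qed.

Let row_dframe x t j :
  row j (dframe x t) = sinh t *: 'D_(e_ j) i x + cosh t *: 'D_(e_ j) N x.
Proof. by rewrite row_comb !rowK. Qed.

Lemma is_derive_frame x (t : R) : is_derive t 1 (frame x) (dframe x t).
Proof. exact: is_derive_row2 (is_derive_cosh t) (is_derive_sinh t). Qed.

Lemma is_derive_dframe x (t : R) : is_derive t 1 (dframe x) (frame x t).
Proof. exact: is_derive_row2 (is_derive_sinh t) (is_derive_cosh t). Qed.

Lemma first_form_gram t x : U x ->
  first_form i N t x = gram (frame x t) (frame x t).
Proof.
by move=> Ux; apply/matrixP => j k; rewrite mxE gramE !row_frame !coord_fieldE.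
Qed.

(** The tangential projection is invisible since the normal is tangent to
    hyperbolic space; then <D_k X_j, N_t> = - <X_j, D_k N_t>. *)
Lemma second_form_gram t x : U x ->
  second_form i N t x = - gram (frame x t) (dframe x t).
Proof.
move=> Ux; apply/matrixP => j k; rewrite [LHS]mxE [RHS]mxE gramE row_frame row_dframe.
rewrite /hcov minkC mink_tproj; last first.
  rewrite /tangent/= parallelE// normal_fieldE// mink_comb.
  by rewrite i_i// [mink (N x) _]minkC i_N// N_N//; ring.
rewrite minkC derive_coord_fieldE// normal_fieldE//.
have di := smooth_derivable x k si Ux; have dN := smooth_derivable x k sN Ux.
have ddi := smooth_derivable2 x j k si Ux.
have ddN := smooth_derivable2 x j k sN Ux.
have iN := D_const _ _ x k 0 (fun y => Di_N y j) Ux ddi dN.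
have ii := D_const _ _ x k 0 (fun y => Di_i y j) Ux ddi di.
have NN := D_const _ _ x k 0 (fun y => DN_N y j) Ux ddN dN.
have Ni := D_const _ _ x k 0 (fun y => DN_i y j) Ux ddN di.
exact: mink_comb_by_parts iN ii NN Ni.
Qed.

(** Symmetry of the second fundamental form along the flow; it reduces to that
    of the initial one. *)
Lemma gram_frame_sym t x : U x ->
  gram (dframe x t) (frame x t) = gram (frame x t) (dframe x t).
Proof.
move=> Ux; apply/matrixP => j k; rewrite !gramE !row_frame !row_dframe.
apply: mink_comb_sym; exact: etrans (shape_sym x j k Ux) (minkC _ _).
Qed.

Lemma gram_dframe t x : U x -> gram (frame x t) (frame x t) \in unitmx ->
  gram (dframe x t) (dframe x t) = gram (dframe x t) (frame x t) *m
    invmx (gram (frame x t) (frame x t)) *m gram (frame x t) (dframe x t).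
Proof.
move=> Ux; apply: (gram_span (i x) (N x)); [exact: i_i|exact: N_N|exact: i_N|..];
  apply/matrixP => r j; rewrite gramE row_id ?row_frame ?row_dframe mxE minkDr !minkZr.
- by rewrite !(minkC (i x)) Di_i// DN_i// !mulr0 addr0.
- by rewrite !(minkC (N x)) Di_N// DN_N// !mulr0 addr0.
- by rewrite !(minkC (i x)) Di_i// DN_i// !mulr0 addr0.
- by rewrite !(minkC (N x)) Di_N// DN_N// !mulr0 addr0.
Qed.

Lemma is_derive_first_form x (t : R) : U x ->
  is_derive t 1 (fun s => first_form i N s x) (- 2 *: second_form i N t x).
Proof.
move=> Ux; rewrite (_ : (fun s => _) = fun s => gram (frame x s) (frame x s)).
  have := is_derive_gram (is_derive_frame x t) (is_derive_frame x t).
  move=> /is_derive_eq; apply.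
  by rewrite gram_frame_sym// second_form_gram// scalerN scaleNr opprK scaler_nat mulr2n.
by apply/funext => s; exact: first_form_gram.
Qed.

Lemma is_derive_second_form x (t : R) : U x ->
  is_derive t 1 (fun s => second_form i N s x)
    (- (gram (dframe x t) (dframe x t) + gram (frame x t) (frame x t))).
Proof.
move=> Ux; rewrite (_ : (fun s => _) = fun s => - gram (frame x s) (dframe x s)).
  exact: is_deriveN (is_derive_gram (is_derive_frame x t) (is_derive_dframe x t)).
by apply/funext => s; exact: second_form_gram.
Qed.

Lemma is_derive_mixed_form x (t : R) : U x -> first_form i N t x \in unitmx ->
  is_derive t 1 (fun s => mixed_form i N s x)
    (mixed_form i N t x *m mixed_form i N t x - 1%:M).
Proof.
move=> Ux uG; apply: riccati => //; first exact: is_derive_first_form.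
have := is_derive_second_form x t Ux; move=> /is_derive_eq; apply.
rewrite first_form_gram// in uG *; rewrite second_form_gram// gram_dframe//.
by rewrite gram_frame_sym// mulNmx mulmxN mulNmx opprK opprD.
Qed.

Lemma is_derive2_second_form x (t : R) : U x ->
  is_derive t 1
    (fun s => - (gram (dframe x s) (dframe x s) + gram (frame x s) (frame x s)))
    (4 *: second_form i N t x).
Proof.
move=> Ux.
have := is_deriveN (is_deriveD
  (is_derive_gram (is_derive_dframe x t) (is_derive_dframe x t))
  (is_derive_gram (is_derive_frame x t) (is_derive_frame x t))).
move=> /is_derive_eq; apply.
rewrite gram_frame_sym// second_form_gram// scalerN; congr (- _).
by rewrite scaler_nat -[4%N]/(2 + 2)%N mulrnDr mulr2n.
Qed.

End Parallel.

(** * The evolution equations *)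

Theorem theorem3p1 (R : realType) (n : nat) (U : set 'rV[R]_n)
    (i N : 'rV[R]_n -> 'rV[R]_n.+2)
    (openU : open U)
    (immersion_i : smooth_immersion U i)
    (normal_N : unit_normal_field U i N) :
  (forall (t : R) (x : 'rV[R]_n) (j k : 'I_n), U x ->
     is_derive t 1 (fun s : R => first_form i N s x j k)
       (- 2 * second_form i N t x j k)) /\
  (forall (t : R) (x : 'rV[R]_n) (j k : 'I_n), U x ->
     first_form i N t x \in unitmx ->
     is_derive t 1 (fun s : R => mixed_form i N s x j k)
       (\sum_(l < n) mixed_form i N t x j l * mixed_form i N t x l k
        - (j == k)%:R)) /\
  (forall (t : R) (x : 'rV[R]_n) (j k : 'I_n), U x ->
     derivable (fun s : R => second_form i N s x j k) t 1 /\
     is_derive t 1 (derive1 (fun s : R => second_form i N s x j k))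
       (4 * second_form i N t x j k)).
Proof.
split=> [t x j k Ux|].
  have := is_derive_first_form openU immersion_i normal_N x t Ux.
  by move=> /is_derive_mxP/(_ j k); rewrite mxE.
split=> [t x j k Ux uG|t x j k Ux].
  have := is_derive_mixed_form openU immersion_i normal_N x t Ux uG.
  by move=> /is_derive_mxP/(_ j k); rewrite !mxE.
have dP s := (is_derive_mxP _ _ _ _).1
  (is_derive_second_form openU immersion_i normal_N x s Ux) j k.
split; first by case: (dP t).
have -> := funext (fun s => is_derive_is_derive1 _ _ _ (dP s)).
have := is_derive2_second_form openU immersion_i normal_N x t Ux.
by move=> /is_derive_mxP/(_ j k); rewrite [X in is_derive _ _ _ X]mxE.
Qed.
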